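(* Let $\varepsilon>0$. For every $p\le \frac{(1-\varepsilon)\ln n}{n}$ and every sufficiently large $n$, in the $p$-random-turn game played on $E(K_n)$, Breaker has an efficient (polynomial-time) strategy that w.h.p. allows him to isolate a vertex in Maker's graph (i.e. at the end of the game some vertex of $K_n$ is incident to no edge claimed by Maker).
   Context: In a $p$-random-turn Maker-Breaker game ($0\le p=p(n)\le 1$) played on the edge set $E(K_n)$ of the complete graph, two players, Maker and Breaker, claim previously unclaimed edges. Before each turn a biased coin is tossed, independently of all other turns: with probability $p$ Maker plays this turn, and with probability $1-p$ Breaker plays it; the chosen player claims exactly one unclaimed edge. The game lasts until all edges are claimed. Maker's graph is the graph on $V(K_n)$ formed by the edges claimed by Maker. A strategy of a player prescribes (possibly using randomization) his next move on the basis of the history of the game so far; it is efficient (polynomial-time) if each move can be computed in time polynomial in $n$. ''W.h.p.'' means with probability tending to $1$ as $n\to\infty$ (over the coin tosses and any randomness of the strategy), against any strategy of the opponent. *)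

(* Defs.v *)
From HB Require Import structures.
From mathcomp Require Import all_boot all_order all_algebra.
From mathcomp Require Import all_classical all_reals all_analysis.
Set Implicit Arguments.
Unset Strict Implicit.
Unset Printing Implicit Defensive.
Import Order.TTheory GRing.Theory Num.Theory.
Local Open Scope ring_scope.

(** * The random-turn game on the edges of the complete graph *)

Inductive player := Maker | Breaker.

Definition is_maker (w : player) : bool := if w is Maker then true else false.
Definition player_of_bool (b : bool) : player := if b then Maker else Breaker.
Lemma is_makerK : cancel is_maker player_of_bool. Proof. by case. Qed.
HB.instance Definition _ := Finite.copy player (can_type is_makerK).

(* The edge {u, v} of K_n is represented by the pair (u, v) with u < v. *)
Definition edge (n : nat) : finType := {e : 'I_n * 'I_n | (e.1 < e.2)%N}.

Definition incident (n : nat) (v : 'I_n) (e : edge n) : bool :=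
  (v == (val e).1) || (v == (val e).2).

(* A history lists, oldest first, who won each toss and the edge then claimed. *)
Definition turn (n : nat) : finType := (player * edge n)%type.
Definition history (n : nat) := seq (turn n).

Definition claimed (n : nat) (h : history n) : seq (edge n) :=
  [seq m.2 | m <- h].

Definition ongoing (n : nat) (h : history n) : bool :=
  uniq (claimed h) && (size h < #|edge n|)%N.

(* A possibly randomized strategy: [S h e] is the probability that, given the
   history [h], the player claims [e].  Its values are constrained only on
   positions that can occur before the end of a game. *)
Record strategy (R : realType) (n : nat) := Strategy {
  strategy_prob :> history n -> edge n -> R;
  strategy_ge0 : forall h e, ongoing h -> 0 <= strategy_prob h e;
  strategy_sum1 : forall h, ongoing h -> \sum_(e : edge n) strategy_prob h e = 1;
  strategy_legal : forall h e, ongoing h -> e \in claimed h ->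
    strategy_prob h e = 0
}.

Section Play.
Variables (R : realType) (n : nat) (p : R) (SM SB : strategy R n).

Definition turn_prob (h : history n) (m : turn n) : R :=
  match m.1 with
  | Maker => p * SM h m.2
  | Breaker => (1 - p) * SB h m.2
  end.

(* Probability that the moves following the history [h] begin with [t]. *)
Fixpoint play_prob (h t : history n) : R :=
  if t is m :: t' then turn_prob h m * play_prob (rcons h m) t' else 1.

Definition maker_isolated (h : history n) (v : 'I_n) : bool :=
  all (fun m : turn n => (m.1 == Maker) ==> ~~ incident v m.2) h.

(* A complete play consists of [#|edge n|] moves. *)
Definition isolation_prob : R :=
  \sum_(t : #|edge n|.-tuple (turn n) | [exists v, maker_isolated t v])
    play_prob [::] t.

End Play.

(** * Polynomial time *)

(* Structured programs for a randomized random-access machine.  Registers and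
   memory cells hold natural numbers, and each step has unit cost.  Addition is
   the only operation that makes numbers grow, so that numbers have at most
   linearly many bits in the running time, and polynomial time has its usual
   meaning. *)
Inductive cmd :=
| Const (x k : nat)               (* x := k *)
| Plus (x y z : nat)              (* x := y + z *)
| Minus (x y z : nat)             (* x := y - z, truncated at 0 *)
| Read (x y : nat)                (* x := ram[y] *)
| Write (x y : nat)               (* ram[x] := y *)
| Flip (x : nat)                  (* x := a fresh random bit *)
| Seq (c1 c2 : cmd)
| If (x : nat) (c1 c2 : cmd)      (* if x <> 0 then c1 else c2 *)
| While (x : nat) (c : cmd).      (* while x <> 0 do c *)

Record state := State { reg : nat -> nat; ram : nat -> nat; tape : seq bool }.

Definition update (f : nat -> nat) (a b : nat) : nat -> nat :=
  fun i => if i == a then b else f i.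

Definition set_reg (s : state) (x k : nat) : state :=
  State (update (reg s) x k) (ram s) (tape s).

(* A configuration is the stack of commands still to be executed, together with
   the state; the machine has halted when the stack is empty. *)
Definition step (cf : seq cmd * state) : seq cmd * state :=
  let: (st, s) := cf in
  if st is c :: st' then
    match c with
    | Const x k => (st', set_reg s x k)
    | Plus x y z => (st', set_reg s x (reg s y + reg s z)%N)
    | Minus x y z => (st', set_reg s x (reg s y - reg s z)%N)
    | Read x y => (st', set_reg s x (ram s (reg s y)))
    | Write x y =>
        (st', State (reg s) (update (ram s) (reg s x) (reg s y)) (tape s))
    | Flip x =>
        (st', set_reg (State (reg s) (ram s) (behead (tape s)))
                      x (head false (tape s)))
    | Seq c1 c2 => ([:: c1, c2 & st'], s)
    | If x c1 c2 => ((if reg s x != 0%N then c1 else c2) :: st', s)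
    | While x c1 => (if reg s x != 0%N then [:: c1, c & st'] else st', s)
    end
  else cf.

Definition encode (n : nat) (h : history n) : seq nat :=
  [:: n, size h & flatten
    [seq [:: is_maker m.1 : nat; val (val m.2).1; val (val m.2).2] | m <- h]].

Definition init (n : nat) (h : history n) (r : seq bool) : state :=
  State (fun=> 0%N) (nth 0%N (encode h)) r.

(* Within [T] steps, on history [h] and random bits [r], the program [c] halts
   with the endpoints of [e] in registers 0 and 1. *)
Definition outputs (c : cmd) (n : nat) (h : history n) (T : nat) (r : seq bool)
    (e : edge n) : bool :=
  let: (st, s) := iter T step ([:: c], init h r) in
  [&& nilp st, reg s 0%N == (val e).1 :> nat & reg s 1%N == (val e).2 :> nat].

(* One program serves all [n].  As the probabilities [S n h e] sum to 1, the
   equation forces the program to halt in time on every random tape. *)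
Definition efficient (R : realType) (S : forall n, strategy R n) : Prop :=
  exists (c : cmd) (d : nat), forall (n : nat) (h : history n) (e : edge n),
    ongoing h ->
    let T := (n ^ d + d)%N in
    S n h e = #|[pred r : T.-tuple bool | outputs c h T r e]|%:R / 2 ^+ T.

(* Main.v *)
Require Import Defs.
From mathcomp Require Import all_boot all_order all_algebra.
From mathcomp Require Import all_classical all_reals all_analysis.
From mathcomp Require Import zify ring lra.
Set Implicit Arguments.
Unset Strict Implicit.
Unset Printing Implicit Defensive.

(** Breaker always claims a free edge at the lowest vertex v not yet touched by
Maker. With q = 1 - p, he wins enough consecutive tosses to isolate v with probability
at least q^n, and a move of Maker touches at most two vertices. Breaker thus gets
about n/2 attempts, which all fail with probability at most (1 - q^n)^((n-1)/2).
This tends to 0, since q >= exp(- (1 + eps) p) for small p, whence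
n q^n >= n^(eps^2). *)

(** * A Hoare logic with running times *)

(** Efficiency refers to a concrete machine, so Breaker's strategy is an explicit program, rerun on
    the whole history before each of his moves; it keeps no record of the attempt under way, and it
    depends neither on p nor on eps. Only the property [good_edge] passes from the program to the
    game. Maker reacts to the tosses, so the attempts are not independent events. Their failure
    probability is instead bounded by induction on the number of moves left, in terms of the number
    of spare attempts and of the free edges left at the current vertex. Every toss won by Maker
    counts as the end of an attempt, wherever he plays. The growth of n q^n is used only through exp
    x >= 1 + x, which leaves a failure probability of at most 4 / (eps^2 ln n). *)

Definition triple (P : state -> Prop) (c : cmd) (t : nat) (Q : state -> Prop) :=
  forall s, P s -> exists s' t',
    [/\ t' <= t, Q s' & forall st, iter t' step (c :: st, s) = (st, s')].

Lemma triple_conseq P c t Q Q' :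
  (forall s, Q s -> Q' s) -> triple P c t Q -> triple P c t Q'.
Proof. by move=> QQ' H s /H[s' [u [le_ut /QQ' ? run]]]; exists s', u. Qed.

(** Fixes the initial state, so that its register contents can appear as parameters in intermediate
    assertions. *)
Lemma triple_point P c t Q :
  (forall s, P s -> triple (eq s) c t Q) -> triple P c t Q.
Proof. by move=> H s Ps; apply: (H s Ps). Qed.

(** Composition works because a triple holds for every stack of pending commands: [c1] runs on top
    of [c2]. The extra step unfolds [Seq]. *)
Lemma triple_seq P Q R c1 c2 t1 t2 :
  triple P c1 t1 Q -> triple Q c2 t2 R ->
  triple P (Seq c1 c2) (t1 + t2).+1 R.
Proof.
move=> H1 H2 s /H1[s1 [u1 [le1 /H2[s2 [u2 [le2 R2 run2]]] run1]]].
exists s2, (u2 + u1 + 1); split=> //; first lia.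
by move=> st; rewrite !iterD /= run1 run2.
Qed.

(** Indexing the invariant by the loop counter yields termination and the cost together: one test
    per round and a final failing one. *)
Lemma triple_countdown x c t (I : nat -> state -> Prop) k :
  (forall j s, I j s -> reg s x = j) ->
  (forall j, triple (I j.+1) c t (I j)) ->
  triple (I k) (While x c) (k * t.+1).+1 (I 0).
Proof.
move=> Ix Ic; elim: k => [|k IHk] s Is.
  by exists s, 1; split=> // st; rewrite /= (Ix _ _ Is).
have [s1 [u1 [le1 /IHk[s2 [u2 [le2 I2 run2]]] run1]]] := Ic k s Is.
exists s2, (u2 + u1 + 1); split=> //; first nia.
by move=> st; rewrite !iterD /= (Ix _ _ Is) /= run1 run2.
Qed.

Fixpoint loop_free (c : cmd) : bool :=
  match c with
  | Seq c1 c2 | If _ c1 c2 => loop_free c1 && loop_free c2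
  | While _ _ => false
  | _ => true
  end.

(** A big-step semantics, so that loop-free code is verified by computation. The values of [exec]
    and [cost] on [While] are dummies, excluded by [loop_free]. *)
Fixpoint exec (c : cmd) (s : state) : state :=
  match c with
  | Seq c1 c2 => exec c2 (exec c1 s)
  | If x c1 c2 => if reg s x != 0 then exec c1 s else exec c2 s
  | _ => (step ([:: c], s)).2
  end.

Lemma exec_seq c1 c2 s : exec (Seq c1 c2) s = exec c2 (exec c1 s).
Proof. by []. Qed.

Fixpoint cost (c : cmd) : nat :=
  match c with
  | Seq c1 c2 => (cost c1 + cost c2).+1
  | If _ c1 c2 => (maxn (cost c1) (cost c2)).+1
  | _ => 1
  end.

Lemma triple_exec (P Q : state -> Prop) c :
  loop_free c -> (forall s, P s -> Q (exec c s)) -> triple P c (cost c) Q.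
Proof.
move=> lfc PQ s /PQ Qs.
suff [u le_u run] : exists2 u, u <= cost c &
    forall st, iter u step (c :: st, s) = (st, exec c s) by exists (exec c s), u.
elim: c lfc s {P PQ Q Qs} => //=.
1-6: by move=> *; exists 1.
- move=> c1 IH1 c2 IH2 /andP[/IH1{}IH1 /IH2{}IH2] s.
  have [u1 le1 run1] := IH1 s; have [u2 le2 run2] := IH2 (exec c1 s).
  exists (u2 + u1 + 1); first lia.
  by move=> st; rewrite !iterD /= run1 run2.
- move=> x c1 IH1 c2 IH2 /andP[/IH1{}IH1 /IH2{}IH2] s.
  have [u1 le1 run1] := IH1 s; have [u2 le2 run2] := IH2 s.
  exists ((if reg s x != 0 then u1 else u2) + 1); first by case: ifP; lia.
  by move=> st; rewrite iterD /=; case: ifP.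
Qed.

Lemma iter_step_halted t s : iter t step ([::], s) = ([::], s).
Proof. by elim: t => //= t ->. Qed.

Infix ";;" := Seq (at level 62, right associativity).

(** * Breaker's program *)

(* Registers: 0, 1 the edge found so far; 2, 3 the ordered pair (a, b) under
   examination; 4 the index of a turn; 5 the constant 1; 6 is nonzero if ab is
   not a free edge, 7 if Maker has touched a; 8 once a free edge at an untouched
   vertex has been found; the other registers are scratch. The loops count down, so
   that a free edge at the lowest untouched vertex is the last one to be stored. *)
Definition skip := Const 9 0.
Definition copy x y := Const x 0 ;; Plus x x y.
(** The machine tests only for zero, so equality of x and y is tested as |x - y| = 0, a sum of two
    truncated differences. *)
Definition dist z x y := Minus 17 y x ;; Minus z x y ;; Plus z z 17.

(** After the two header cells, turn k occupies the cells 3k+2 to 3k+4. At the end, register 16 is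
    zero iff the edge of the turn is (a, b), register 15 iff it is (b, a), and 13 or 14 iff it is
    incident to a. *)
Definition fetch_turn : cmd :=
  Minus 4 4 5 ;;
  Plus 9 4 4 ;; Plus 9 9 4 ;; Plus 9 9 5 ;;
  Plus 9 9 5 ;; Read 10 9 ;; Plus 9 9 5 ;; Read 11 9 ;; Plus 9 9 5 ;; Read 12 9 ;;
  dist 13 11 2 ;; dist 14 12 2 ;; dist 15 11 3 ;; dist 16 12 3 ;;
  Plus 16 13 16 ;; Plus 15 14 15.

Definition note_taken : cmd := If 16 (If 15 skip (Const 6 1)) (Const 6 1).
Definition note_touched : cmd :=
  If 10 (If 13 (If 14 skip (Const 7 1)) (Const 7 1)) skip.

Definition examine_turn : cmd := fetch_turn ;; note_taken ;; note_touched.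

(** Register 6 starts at 1 on the diagonal, so that a = b counts as taken. [Read 4 5] loads the
    length of the history from cell 1, the address being the constant 1. *)
Definition start_pair : cmd :=
  Minus 3 3 5 ;; dist 6 2 3 ;; Minus 6 5 6 ;; Const 7 0 ;; Read 4 5.

Definition keep_pair : cmd :=
  Minus 9 2 3 ;; If 9 (copy 0 3 ;; copy 1 2) (copy 0 2 ;; copy 1 3).

(** A free pair at a touched vertex is stored only while no better one is known. This fallback gives
    Breaker a legal move when no untouched vertex has a free edge. *)
Definition select : cmd :=
  If 6 skip (If 7 (If 8 skip keep_pair) (keep_pair ;; Const 8 1)).

Definition examine_pair : cmd := start_pair ;; While 4 examine_turn ;; select.

Definition start_row : cmd := Minus 2 2 5 ;; Const 9 0 ;; Read 3 9.
Definition examine_row : cmd := start_row ;; While 3 examine_pair.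

(** Register 2 is initially 0, so [Read 2 2] loads n from cell 0. *)
Definition breaker_cmd : cmd :=
  (Const 5 1 ;; Read 2 2) ;; While 2 examine_row.

(** * Correctness of the program: examining the turns for one pair *)

Section Correctness.
Variables (n : nat) (h : history n).

Definition joins (a b : 'I_n) (e : edge n) :=
  ((val e).1 == a) && ((val e).2 == b) || ((val e).1 == b) && ((val e).2 == a).

Definition free (a b : 'I_n) :=
  ~~ ((a == b) || has (fun m : turn n => joins a b m.2) h).

Definition clean (a : 'I_n) :=
  ~~ has (fun m : turn n => (m.1 == Maker) && incident a m.2) h.

Lemma encode_turn (m0 : turn n) i : i < size h ->
  let m := nth m0 h i in
  [/\ nth 0 (encode h) (i.*2 + i).+2 = is_maker m.1,
      nth 0 (encode h) (i.*2 + i).+3 = (val m.2).1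
    & nth 0 (encode h) (i.*2 + i).+4 = (val m.2).2].
Proof.
rewrite /encode /=; elim: h i => // m g IHg [|i] // lt_i.
have -> : i.+1.*2 + i.+1 = (i.*2 + i).+3 by lia.
exact: IHg.
Qed.


(** The counter k runs down, so the turns already seen form the tail [drop k h]. The parameters x,
    y, f are the choice made before this pair, which the loop must preserve. *)
Record turns_examined (a b : 'I_n) (x y f k : nat) (s : state) : Prop := {
  te_out0 : reg s 0 = x;
  te_out1 : reg s 1 = y;
  te_a : reg s 2 = a;
  te_b : reg s 3 = b;
  te_k : reg s 4 = k;
  te_one : reg s 5 = 1;
  te_found : reg s 8 = f;
  te_ram : ram s = nth 0 (encode h);
  te_le : k <= size h;
  te_taken : (reg s 6 != 0) =
    (a == b) || has (fun m : turn n => joins a b m.2) (drop k h);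
  te_touched : (reg s 7 != 0) =
    has (fun m : turn n => (m.1 == Maker) && incident a m.2) (drop k h) }.

Lemma exec_fetch_turn (m0 : turn n) a b x y f k s :
    turns_examined a b x y f k.+1 s ->
  let s' := exec fetch_turn s in
  let: (w, e) := nth m0 h k in let: (u, v) := val e in
  [/\ ram s' = ram s, reg s' 4 = k,
      forall j, j \in [:: 0; 1; 2; 3; 5; 6; 7; 8] -> reg s' j = reg s j
    & [/\ reg s' 10 = is_maker w,
      reg s' 13 = (u - a) + (a - u), reg s' 14 = (v - a) + (a - v),
      reg s' 15 = (v - a) + (a - v) + ((u - b) + (b - u))
    & reg s' 16 = (u - a) + (a - u) + ((v - b) + (b - v)) ]].
Proof.
case: s => rg rm tp [_ _ ra rb rk r5 _ rr lek _ _]; simpl in ra, rb, rk, r5, rr.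
have := encode_turn m0 lek; rewrite -rr.
case: (nth m0 h k) => w e; case eE: (val e) => [u v] [].
rewrite [(w, e).2]/= [(w, e).1]/= eE [(u, v).1]/= [(u, v).2]/= => ew eu ev.
have ek : 1 + (1 + (k + k + k)) = (k.*2 + k).+2 by rewrite -addnn; lia.
split.
- by lazy.
- by lazy -[subn]; rewrite rk r5 subSS subn0.
- by move=> j; rewrite !inE => /or4P[/eqP->|/eqP->|/eqP->|/or4P[/eqP->|/eqP->|/eqP->|/orP[/eqP->|/eqP->]]].
- have E : rg 4 - rg 5 + (rg 4 - rg 5) + (rg 4 - rg 5) + rg 5 + rg 5 = (k.*2 + k).+2 by rewrite rk r5; lia.
  split; lazy -[addn subn double is_maker nat_of_bool]; rewrite !E ?r5 ?addn1.
  all: by rewrite ?ew ?eu ?ev ?ra ?rb.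
Qed.

Lemma exec_note_taken s (s' := exec note_taken s) :
  [/\ ram s' = ram s, forall j, j != 6 -> j != 9 -> reg s' j = reg s j
    & (reg s' 6 != 0) = [|| reg s 16 == 0, reg s 15 == 0 | reg s 6 != 0]].
Proof.
rewrite {}/s' /note_taken; cbn [exec].
by case: (reg s 16 == 0); case: (reg s 15 == 0);
  split=> //= j /negPf j6 /negPf j9; rewrite /update ?j6 ?j9.
Qed.

Lemma exec_note_touched s (s' := exec note_touched s) :
  [/\ ram s' = ram s, forall j, j != 7 -> j != 9 -> reg s' j = reg s j
    & (reg s' 7 != 0) =
      (reg s 10 != 0) && ((reg s 13 == 0) || (reg s 14 == 0)) || (reg s 7 != 0)].
Proof.
rewrite {}/s' /note_touched; cbn [exec].
by case: (reg s 10 == 0); case: (reg s 13 == 0); case: (reg s 14 == 0);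
  split=> //= j /negPf j7 /negPf j9; rewrite /update ?j7 ?j9.
Qed.

Lemma dist_eq0 (u v : nat) : (u - v + (v - u) == 0) = (u == v).
Proof. by rewrite addn_eq0 !subn_eq0 eqn_leq. Qed.

Lemma examine_turn_correct a b x y f k :
  triple (turns_examined a b x y f k.+1) examine_turn (cost examine_turn)
         (turns_examined a b x y f k).
Proof.
apply: triple_exec => // s Hs.
(* A default value for [nth]; if no turn exists at all, [h] is empty, against k < size h. *)
have [m0 _|h0] := pickP (predT : pred (turn n)); last first.
  by have := te_le Hs; case: (h) => // m; have := h0 m.
have := exec_fetch_turn m0 Hs.
have dk : drop k h = nth m0 h k :: drop k.+1 h by rewrite (drop_nth m0) ?(te_le Hs).
rewrite /examine_turn exec_seq (exec_seq note_taken).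
move: (exec fetch_turn s) => s1.
case Em: (nth m0 h k) => [w e]; case Ee: (val e) => [u v].
move=> [rr1 rk1 keep1 [e10 e13 e14 e15 e16]].
have := exec_note_taken s1.
move: (exec note_taken s1) => s2 [rr2 keep2 e6].
have := exec_note_touched s2.
move: (exec note_touched s2) => s3 [rr3 keep3 e7].
case: Hs => r0 r1 ra rb _ r5 r8 rr lek r6 r7.
split.
- by rewrite keep3 ?keep2 ?keep1.
- by rewrite keep3 ?keep2 ?keep1.
- by rewrite keep3 ?keep2 ?keep1.
- by rewrite keep3 ?keep2 ?keep1.
- by rewrite keep3 ?keep2 ?rk1.
- by rewrite keep3 ?keep2 ?keep1.
- by rewrite keep3 ?keep2 ?keep1.
- by rewrite rr3 rr2 rr1.
- exact: ltnW.
- rewrite keep3 // e6 e15 e16 keep1 // r6 dk Em /= /joins Ee /=.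
  rewrite ![_ + _ + (_ + _) == 0]addn_eq0 !dist_eq0.
  by rewrite (andbC (v == a)) orbA orbCA.
- rewrite e7 !keep2 // e10 e13 e14 keep1 // r7 dk Em /= /incident Ee /= !dist_eq0.
  by rewrite (eq_sym a u) (eq_sym a v); case: w {Em e10}.
Qed.

(** * The choice maintained while scanning all pairs *)

Definition output (a b : 'I_n) (x y : nat) := x = minn a b /\ y = maxn a b.

(** Here D is the set of pairs scanned so far. Only a has to be minimal, as any free edge at the
    lowest vertex serves Breaker. *)
Definition selected (D : 'I_n -> 'I_n -> Prop) (x y f : nat) : Prop :=
  if f != 0 then
    exists a b, [/\ D a b, free a b, clean a, output a b x y
      & forall a' b', D a' b' -> free a' b' -> clean a' -> a <= a']
  else
    (forall a b, D a b -> free a b -> ~~ clean a) /\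
    ((exists a b, [/\ D a b, free a b & output a b x y])
     \/ forall a b, D a b -> ~~ free a b).

(** As rows are scanned downwards, the new a is minimal among all pairs scanned, so a new free pair
    at an untouched a may overwrite the stored one without comparison. *)
Lemma selected_add (D D' : 'I_n -> 'I_n -> Prop) a b x y f x' y' f' :
  selected D x y f ->
  (forall a' b', D' a' b' <-> D a' b' \/ (a' = a /\ b' = b)) ->
  (forall a' b', D' a' b' -> a <= a') ->
  (if free a b && (clean a || (f == 0))
   then output a b x' y' /\ f' = (if clean a then 1 else f)
   else [/\ x' = x, y' = y & f' = f]) ->
  selected D' x' y' f'.
Proof.
move=> sel D'E le_a.
have D'ab : D' a b by apply/D'E; right.
have DD' a' b' : D a' b' -> D' a' b' by move=> ?; apply/D'E; left.
case: ifPn => [/andP[free_ab]|].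
  case: ifP => [clean_a _ [out ->]|clean_a /= /eqP f0 [out ->]].
    by exists a, b; split=> // a' b' /le_a.
  rewrite /selected f0 /= in sel *; split; last by left; exists a, b.
  by move=> a' b' /D'E[/(proj1 sel)//|[-> _]]; rewrite clean_a.
rewrite negb_and negb_or => skip_ab [-> -> ->].
rewrite /selected in sel *; case: ifPn sel => [f1 [a1 [b1 [D1 free1 clean1 out1 min1]]]|].
  exists a1, b1; split=> //; first exact: DD'.
  move=> a' b' /D'E[/min1//|[-> ->]] free_ab clean_a.
  by move: skip_ab; rewrite free_ab clean_a.
rewrite negbK => f0 [dirty1 sel]; move: skip_ab; rewrite f0 andbF orbF => taken_ab.
split; first by move=> a' b' /D'E[/dirty1//|[-> ->]]; rewrite (negPf taken_ab).
case: sel => [[a1 [b1 [D1 free1 out1]]]|taken]; [left; exists a1, b1|right].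
  by split=> //; apply: DD'.
by move=> a' b' /D'E[/taken//|[-> ->]].
Qed.

Lemma exec_keep_pair s (s' := exec keep_pair s) :
  [/\ ram s' = ram s, reg s' 0 = minn (reg s 2) (reg s 3),
      reg s' 1 = maxn (reg s 2) (reg s 3)
    & forall j, j \in [:: 2; 3; 5; 8] -> reg s' j = reg s j].
Proof.
rewrite {}/s' /keep_pair exec_seq; set s1 := exec _ s.
have [rr1 e9 keep1] : [/\ ram s1 = ram s, reg s1 9 = reg s 2 - reg s 3
   & forall j, j \in [:: 2; 3; 5; 8] -> reg s1 j = reg s j].
  by split=> // j; rewrite !inE => /or4P[]/eqP->.
move: {s1}(s1) rr1 e9 keep1 => s1 <- e9 keep1; cbn [exec].
rewrite e9 subn_eq0; case: leqP => le; (split; [by []|..]).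
- by rewrite /= /update /= !keep1 //; lia.
- by rewrite /= /update /= !keep1 //; lia.
- by move=> j Uj; rewrite -keep1 //; move: Uj; rewrite !inE => /or4P[]/eqP->.
- by rewrite /= /update /= !keep1 //; lia.
- by rewrite /= /update /= !keep1 //; lia.
- by move=> j Uj; rewrite -keep1 //; move: Uj; rewrite !inE => /or4P[]/eqP->.
Qed.

Lemma exec_select s (s' := exec select s)
    (good := (reg s 6 == 0) && ((reg s 7 == 0) || (reg s 8 == 0))) :
  [/\ ram s' = ram s, forall j, j \in [:: 2; 3; 5] -> reg s' j = reg s j
    & if good then
        [/\ reg s' 0 = minn (reg s 2) (reg s 3), reg s' 1 = maxn (reg s 2) (reg s 3)
          & reg s' 8 = if reg s 7 == 0 then 1 else reg s 8]
      else [/\ reg s' 0 = reg s 0, reg s' 1 = reg s 1 & reg s' 8 = reg s 8]].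
Proof.
rewrite {}/s' {}/good.
have [rr0 e0 e1 keep] := exec_keep_pair s.
have skip_case s1 : [/\ ram (exec skip s1) = ram s1,
    forall j, j \in [:: 2; 3; 5] -> reg (exec skip s1) j = reg s1 j
  & [/\ reg (exec skip s1) 0 = reg s1 0, reg (exec skip s1) 1 = reg s1 1
    & reg (exec skip s1) 8 = reg s1 8]].
  by split=> // j; rewrite !inE => /or3P[]/eqP->.
rewrite /select; cbn [exec]; move: (exec keep_pair s) rr0 e0 e1 keep => s1 rr0 e0 e1 keep.
case: (reg s 6 =P 0) => _; last exact: (skip_case s).
case: (reg s 7 =P 0) => _ /=.
  split=> // j; rewrite !inE => /or3P[]/eqP->; rewrite /update /=; exact: keep.
case: (reg s 8 =P 0) => _; last exact: (skip_case s).
split=> //; last by split=> //; apply: keep.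
by move=> j; rewrite !inE => /or3P[]/eqP->; exact: keep.
Qed.

Lemma exec_start_pair s (s' := exec start_pair s) : reg s 5 = 1 ->
  [/\ ram s' = ram s, reg s' 3 = (reg s 3).-1, reg s' 4 = ram s 1,
      forall j, j \in [:: 0; 1; 2; 5; 8] -> reg s' j = reg s j
    & (reg s' 6 != 0) = (reg s 2 == (reg s 3).-1) /\ reg s' 7 = 0].
Proof.
rewrite {}/s' -subn1; case: s => rg rm tp r5; simpl in r5; split.
- by lazy.
- by lazy -[subn]; rewrite r5.
- by lazy; rewrite r5.
- by move=> j; rewrite !inE => /or4P[/eqP->|/eqP->|/eqP->|/orP[]/eqP->]; lazy.
- split; last by lazy.
  set r := reg _ 6; have -> : r = rg 5 - (rg 2 - (rg 3 - rg 5) + (rg 3 - rg 5 - rg 2)).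
    by lazy -[subn addn].
  rewrite r5 [reg _ 2]/= [reg _ 3]/= -[RHS]dist_eq0; lia.
Qed.

Record row_examined (a : 'I_n) (l : nat) (s : state) : Prop := {
  re_a : reg s 2 = a;
  re_b : reg s 3 = l;
  re_one : reg s 5 = 1;
  re_ram : ram s = nth 0 (encode h);
  re_le : l <= n;
  re_selected : selected (fun a' b' => a < a' \/ a' = a /\ l <= b')
                         (reg s 0) (reg s 1) (reg s 8) }.

Definition pair_cost : nat :=
  (cost start_pair +
    ((size h * (cost examine_turn).+1).+1 + cost select).+1).+1.

Lemma examine_pair_correct a l :
  triple (row_examined a l.+1) examine_pair pair_cost (row_examined a l).
Proof.
apply: triple_point => s0 Hs0; have [ra rb r5 rr lel sel] := Hs0.
pose b : 'I_n := Ordinal lel.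
pose x := reg s0 0; pose y := reg s0 1; pose f := reg s0 8.
apply: (triple_seq (Q := turns_examined a b x y f (size h))).
  apply: triple_exec => // s <-.
  have := exec_start_pair r5; move: (exec start_pair s0) => s1.
  rewrite rb ra rr /= => -[rr1 rb1 rk1 keep1 [e6 e7]].
  split; rewrite ?drop_size ?e6 ?orbF ?e7 //; exact: keep1 || by rewrite keep1.
apply: (triple_seq (Q := turns_examined a b x y f 0)).
  apply: triple_countdown => [j s /te_k//|j].
  exact: examine_turn_correct.
apply: triple_exec => // s [q0 q1 qa qb _ q5 q8 qr _].
rewrite !drop0 => q6 q7.
have := exec_select s; move: (exec select s) => s1 [rr1 keep1 out1].
split; try by rewrite keep1.
- by rewrite rr1.
- exact: ltnW.
apply: (selected_add (a := a) (b := b) sel).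
- move=> a' b'; split=> [[?|[-> le]]|]; first by left; left.
    case: (ltngtP l b') le => // [lt|eq] _; first by left; right.
    by right; split=> //; apply: val_inj.
  by case=> [[?|[-> /ltnW]]|[-> ->]]; [left|right|right].
- by move=> a' b' [/ltnW|[->]].
- move: out1; rewrite /free /clean -q6 -q7 !negbK q8 qa qb q0 q1.
  by case: ifP => _ [-> -> ->].
Qed.

Record rows_examined (k : nat) (s : state) : Prop := {
  rs_a : reg s 2 = k;
  rs_one : reg s 5 = 1;
  rs_ram : ram s = nth 0 (encode h);
  rs_le : k <= n;
  rs_selected : selected (fun a' _ => k <= a') (reg s 0) (reg s 1) (reg s 8) }.

Definition row_cost : nat := (cost start_row + (n * pair_cost.+1).+1).+1.

Lemma eq_selected (D D' : 'I_n -> 'I_n -> Prop) x y f :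
  (forall a b, D a b <-> D' a b) -> selected D x y f -> selected D' x y f.
Proof.
move=> DD'; rewrite /selected; case: ifP => _.
  case=> a [b [Dab ? ? ? min_a]]; exists a, b; split=> //; first exact/DD'.
  by move=> a' b' /DD'; apply: min_a.
case=> dirty sel; split; first by move=> a b /DD'; apply: dirty.
case: sel => [[a [b [/DD' ? ? ?]]]|taken]; [by left; exists a, b|right].
by move=> a b /DD'; apply: taken.
Qed.

Lemma examine_row_correct k :
  triple (rows_examined k.+1) examine_row row_cost (rows_examined k).
Proof.
apply: triple_point => s0 [ra r5 rr lek sel].
pose a : 'I_n := Ordinal lek.
apply: (triple_seq (Q := row_examined a n)).
  apply: triple_exec => // s <-; case: s0 ra r5 rr sel => rg rm tp /= ra r5 -> sel.
  split=> //=; rewrite /update /= ?ra ?r5 ?subSS ?subn0 //.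
  apply: eq_selected sel => a' b'; split=> [?|[//|[_]]]; first by left.
  by rewrite leqNgt ltn_ord.
apply: (triple_conseq (Q := row_examined a 0)); last first.
  by apply: triple_countdown => [l s /re_b//|l]; apply: examine_pair_correct.
move=> s [ra' _ r5' rr' _ sel']; split=> //; first exact: ltnW.
apply: eq_selected sel' => a' b'; split=> [[/ltnW//|[-> _]//]|].
by rewrite leq_eqVlt => /orP[/eqP eq|]; [right; split=> //; apply: val_inj|left].
Qed.

Definition breaker_cost : nat := (cost (Const 5 1 ;; Read 2 2) + (n * row_cost.+1).+1).+1.

Lemma breaker_cmd_correct :
  triple (fun s => exists r, s = init h r) breaker_cmd breaker_cost
    (rows_examined 0).
Proof.
apply: (triple_seq (Q := rows_examined n)).
  apply: triple_exec => // _ [r ->]; split=> //.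
  by split=> [a b|]; [|right=> a b]; rewrite leqNgt ltn_ord.
apply: triple_countdown => [k s /rs_a//|k]; exact: examine_row_correct.
Qed.

(** * From the stored pair to a good move *)

Definition target (v : 'I_n) :=
  maker_isolated h v /\ forall u : 'I_n, u < v -> ~~ maker_isolated h u.

(** All that the game analysis needs of Breaker's move. Once the target has no free edge left, it is
    isolated for good and any legal move will do. *)
Definition good_edge (e : edge n) :=
  e \notin claimed h /\
  forall v, target v -> (exists2 e', incident v e' & e' \notin claimed h) ->
    incident v e.

Lemma cleanE v : clean v = maker_isolated h v.
Proof.
rewrite /clean /maker_isolated -all_predC; apply: eq_all => m /=.
by rewrite negb_and implybE.
Qed.

Lemma joinsE a b (e e' : edge n) : joins a b e -> joins a b e' -> e = e'.
Proof.
case: e e' => [[u v] /= uv] [[u' v'] /= uv'].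
by rewrite /joins /= => /orP[]/andP[/eqP eu /eqP ev] /orP[]/andP[/eqP eu' /eqP ev'];
  subst; apply: val_inj => //=; lia.
Qed.

Lemma free_notin a b (e : edge n) :
  joins a b e -> free a b = (e \notin claimed h).
Proof.
move=> ab_e; rewrite /free negb_or.
have -> /= : a != b.
  apply: contraTneq ab_e => ->; case: e => [[u v] /= uv]; rewrite /joins /=.
  by apply/negP => /orP[]/andP[/eqP eu /eqP ev]; subst; rewrite ltnn in uv.
congr (~~ _); apply/hasP/mapP => [[m mh ab_m]|[m mh em]].
  by exists m => //; apply: joinsE ab_m.
by exists m => //; rewrite -em.
Qed.

Lemma free_edge a b : free a b ->
  exists2 e : edge n, joins a b e & output a b (val e).1 (val e).2.
Proof.
rewrite /free negb_or => /andP[ne_ab _]; rewrite /output /joins.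
case: (ltngtP a b) => [lt|lt|/val_inj eq]; last by rewrite eq eqxx in ne_ab.
  by exists (exist _ (a, b) lt) => //=; rewrite !eqxx.
by exists (exist _ (b, a) lt) => //=; rewrite !eqxx orbT.
Qed.

Lemma incident_joins v (e : edge n) : incident v e -> exists b, joins v b e.
Proof.
rewrite /incident /joins => /orP[]/eqP->.
  by exists (val e).2; rewrite !eqxx.
by exists (val e).1; rewrite !eqxx orbT.
Qed.

Lemma joins_incident a b (e : edge n) : joins a b e -> incident a e.
Proof.
by rewrite /incident /joins => /orP[]/andP[/eqP-> /eqP->]; rewrite eqxx ?orbT.
Qed.

Lemma ongoing_unclaimed : ongoing h -> exists e, e \notin claimed h.
Proof.
case/andP=> uniq_h lt_h; apply/existsP; apply: contraTT lt_h => /existsPn all_h.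
rewrite -leqNgt -(size_map snd) -(card_uniqP uniq_h).
by apply: subset_leq_card; apply/fintype.subsetP => e _; have := all_h e; rewrite negbK.
Qed.

(** If a stored pair has untouched a and the target v has a free edge, minimality of a gives a <= v
    and minimality of v gives v <= a. Otherwise no untouched vertex has a free edge, the condition
    at the target is vacuous, and the fallback exists because the game is ongoing. *)
Lemma selected_good_edge x y f : ongoing h -> selected (fun _ _ => True) x y f ->
  exists e, [/\ good_edge e, x = (val e).1 & y = (val e).2].
Proof.
move=> /ongoing_unclaimed [e0 e0_free]; rewrite /selected; case: ifP => _.
  case=> a [b [_ free_ab clean_a [-> ->] min_a]].
  have [e ab_e [eu ev]] := free_edge free_ab.
  exists e; split=> //; split; first by rewrite -(free_notin ab_e).
  move=> v [iso_v min_v] [e' /incident_joins[b' vb'_e'] e'_free].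
  have le_av : a <= v by apply: (min_a v b'); rewrite ?(free_notin vb'_e') ?cleanE.
  have le_va : v <= a by rewrite leqNgt; apply/negP => /min_v; rewrite -cleanE clean_a.
  have -> : v = a by apply/val_inj/eqP; rewrite eqn_leq le_va.
  exact: joins_incident ab_e.
case=> dirty []; last first.
  have [b ab_e0] : exists b, joins (val e0).1 b e0.
    by apply: incident_joins; rewrite /incident eqxx.
  by move=> /(_ _ b I) taken; move: e0_free; rewrite -(free_notin ab_e0) (negPf (taken _)).
case=> a [b [_ free_ab [-> ->]]]; have [e ab_e [eu ev]] := free_edge free_ab.
exists e; split=> //; split; first by rewrite -(free_notin ab_e).
move=> v [iso_v _] [e' /incident_joins[b' vb'_e'] e'_free].
by have := dirty v b' I; rewrite (free_notin vb'_e') cleanE iso_v => /(_ e'_free).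
Qed.

Lemma breaker_cmd_outputs T r : breaker_cost <= T -> ongoing h ->
  exists2 e0, good_edge e0 & forall e, outputs breaker_cmd h T r e = (e == e0).
Proof.
move=> le_T ong.
have [s [t [le_t [_ _ _ _ sel] run]]] :=
  breaker_cmd_correct (ex_intro _ r (erefl (init h r))).
have [|e0 [good0 out0 out1]] := @selected_good_edge (reg s 0) (reg s 1) (reg s 8) ong.
  by apply: eq_selected sel.
exists e0 => // e; rewrite /outputs -(subnK (leq_trans le_t le_T)) iterD.
rewrite run iter_step_halted /= out0 out1.
apply/andP/eqP => [[/eqP eu /eqP ev]|->]; last by split; apply/eqP.
case: e e0 {good0 out0 out1} eu ev => [[u v] uv] [[u' v'] uv'] /=.
by move=> /val_inj eu /val_inj ev; apply: val_inj; rewrite /= eu ev.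
Qed.

(** * A polynomial bound on the running time *)

Lemma card_edge : #|edge n| <= n ^ 2.
Proof.
rewrite card_sig; apply: leq_trans (max_card _) _.
by rewrite card_prod card_ord mulnn.
Qed.

(** The cost is of order n^4: n rows of n pairs, each with at most n^2 turns. An ongoing game has n
    >= 2, so the spare factor n^16 >= 2^16 absorbs all constants. *)
Lemma breaker_cost_le : ongoing h -> breaker_cost <= n ^ 20 + 20.
Proof.
case/andP=> _ lt_h.
have le_h : size h <= n * n by rewrite mulnn (leq_trans (ltnW lt_h) card_edge).
have n_gt1 : 1 < n.
  rewrite ltnNge; apply: contraTN lt_h => n_le1; rewrite -leqNgt.
  have /leq_trans->// : #|edge n| <= 0.
  rewrite leqNgt; apply/card_gt0P => -[[[u v] /= uv] _].
  by have := ltn_ord v; lia.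
have c1 : cost examine_turn <= 100 by [].
have c2 : cost start_pair + cost select <= 100 by [].
have c3 : cost start_row <= 100 by [].
have c4 : cost (Const 5 1 ;; Read 2 2) <= 100 by [].
rewrite /breaker_cost /row_cost /pair_cost.
move: (cost examine_turn) (cost start_pair) (cost select) (cost start_row)
  (cost (Const 5 1 ;; Read 2 2))
  c1 c2 c3 c4 => t1 t2 t3 t4 t5 c1 c2 c3 c4.
have n20 : 512 * (n * (n * (n * n))) <= n ^ 20.
  have -> : n * (n * (n * n)) = n ^ 4 by rewrite !expnS muln1.
  rewrite (expnD n 16 4) leq_mul // (@leq_trans (2 ^ 16)) ?leq_exp2r //.
have nn : 2 * 2 <= n * n by rewrite leq_mul.
have b1 : (size h * t1.+1).+1 <= 101 * (n * n) + 1 by nia.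
set x1 := (size h * _).+1 in b1 *.
have b2 : n * (t2 + (x1 + t3).+1).+2 <= n * (128 * (n * n)) by rewrite leq_mul //; lia.
set x2 := n * _ in b2 *.
have nnn : 2 * (2 * 2) <= n * (n * n) by rewrite leq_mul.
have b3 : n * (t4 + x2.+1).+2 <= n * (256 * (n * (n * n))) by rewrite leq_mul //; lia.
set x3 := n * _ in b3 *.
have nnnn : 2 * (2 * (2 * 2)) <= n * (n * (n * n)) by rewrite leq_mul.
lia.
Qed.

End Correctness.

Import Order.TTheory GRing.Theory Num.Theory.
Import numFieldNormedType.Exports.
Local Open Scope ring_scope.

(** * The value of the game against Breaker's strategy *)

Section BreakerStrategy.
Variables (R : realType) (n : nat).

Definition run_time := (n ^ 20 + 20)%N.

(* Reading the strategy off the program makes its efficiency definitional. *)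
Definition breaker_prob (h : history n) (e : edge n) : R :=
  #|[pred r : run_time.-tuple bool | outputs breaker_cmd h run_time r e]|%:R
  / 2 ^+ run_time.

Lemma breaker_prob_ge0 h e : ongoing h -> 0 <= breaker_prob h e.
Proof. by rewrite divr_ge0 ?exprn_ge0. Qed.

Lemma breaker_prob_good h e :
  ongoing h -> breaker_prob h e != 0 -> good_edge h e.
Proof.
move=> ong; rewrite /breaker_prob mulf_eq0 negb_or pnatr_eq0 -lt0n => /andP[+ _].
case/card_gt0P => r; rewrite inE.
have [e0 good0 ->] := breaker_cmd_outputs r (breaker_cost_le ong) ong.
by move/eqP->.
Qed.

(** Each random tape leads to exactly one edge, so exchanging the sums counts every tape once. *)
Lemma breaker_prob_sum1 h : ongoing h -> \sum_e breaker_prob h e = 1.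
Proof.
move=> ong; rewrite -mulr_suml -natr_sum.
under eq_bigr do rewrite -sum1_card big_mkcond.
rewrite exchange_big /= (eq_bigr (fun=> 1%N)) => [|r _].
  by rewrite sum1_card card_tuple card_bool natrX divff // expf_neq0.
have [e0 _ out0] := breaker_cmd_outputs r (breaker_cost_le ong) ong.
by rewrite -big_mkcond (eq_bigl (pred1 e0)) ?big_pred1_eq //.
Qed.

Lemma breaker_prob_legal h e :
  ongoing h -> e \in claimed h -> breaker_prob h e = 0.
Proof.
move=> ong e_h; apply/eqP; apply: contraTT e_h => /(breaker_prob_good ong).
by case.
Qed.

Definition breaker_strategy : strategy R n :=
  Strategy breaker_prob_ge0 breaker_prob_sum1 breaker_prob_legal.

End BreakerStrategy.

Lemma breaker_efficient (R : realType) : efficient (breaker_strategy R).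
Proof. by exists breaker_cmd, 20%N. Qed.

Section Value.
Variables (R : realType) (n : nat) (p : R) (SM SB : strategy R n).
Hypothesis p_prob : 0 <= p <= 1.
Hypothesis SB_good : forall h e, ongoing h -> SB h e != 0 -> good_edge h e.

Local Notation N := #|edge n|.
Local Notation q := (1 - p).

(** The probability, with r moves still to come after [h], that some vertex ends up isolated; this
    form allows induction on r. *)
Fixpoint value (r : nat) (h : history n) : R :=
  if r is r'.+1 then \sum_m turn_prob p SM SB h m * value r' (rcons h m)
  else [exists v, maker_isolated h v]%:R.

Lemma sum_play_prob r h :
  \sum_(t : r.-tuple (turn n) | [exists v, maker_isolated (h ++ t) v])
    play_prob p SM SB h t = value r h.
Proof.
elim: r h => [|r IHr] h /=; rewrite big_mkcond /=.
  rewrite (bigD1 [tuple]) //= big1 => [|t /eqP[]]; last exact: tuple0.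
  by rewrite cats0 addr0; case: ifP.
rewrite (reindex (fun mt : turn n * r.-tuple (turn n) => [tuple of mt.1 :: mt.2])) /=.
  rewrite -(pair_bigA _ (fun m (t : r.-tuple _) =>
    if [exists v, maker_isolated (h ++ m :: t) v] then
      turn_prob p SM SB h m * play_prob p SM SB (rcons h m) t else 0)) /=.
  apply: eq_bigr => m _; rewrite -IHr mulr_sumr [RHS]big_mkcond.
  by apply: eq_bigr => t _; rewrite cat_rcons.
exists (fun t => (thead t, [tuple of behead t])) => [[m t] _|t _] /=.
  by congr (_, _); apply: val_inj.
by rewrite -tuple_eta.
Qed.

Lemma valueS r h :
  value r.+1 h =
    p * \sum_e SM h e * value r (rcons h (Maker, e))
    + q * \sum_e SB h e * value r (rcons h (Breaker, e)).
Proof.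
transitivity (\sum_w \sum_e
    turn_prob p SM SB h (w, e) * value r (rcons h (w, e))).
  by rewrite pair_bigA; apply: eq_bigr => -[].
rewrite (reindex player_of_bool) /=; last first.
  by exists is_maker => w _; [case: w|rewrite is_makerK].
rewrite big_bool /= !mulr_sumr /turn_prob /=.
by congr (_ + _); apply: eq_bigr => e _; rewrite mulrA.
Qed.

(** Requiring the bound only where [S h e] is nonzero lets legality, and for Breaker [good_edge], be
    assumed of the move. *)
Lemma expect_ge (S : strategy R n) h (F : edge n -> R) c : ongoing h ->
  (forall e, S h e != 0 -> c <= F e) -> c <= \sum_e S h e * F e.
Proof.
move=> ong leF; rewrite -[c]mul1r -(strategy_sum1 S ong) mulr_suml.
apply: ler_sum => e _; have [->|ne0] := eqVneq (S h e) 0; first by rewrite !mul0r.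
by rewrite ler_wpM2l ?strategy_ge0 ?leF.
Qed.

Lemma expect_le (S : strategy R n) h (F : edge n -> R) c : ongoing h ->
  (forall e, S h e != 0 -> F e <= c) -> \sum_e S h e * F e <= c.
Proof.
move=> ong leF; rewrite -[leRHS]mul1r -(strategy_sum1 S ong) mulr_suml.
apply: ler_sum => e _; have [->|ne0] := eqVneq (S h e) 0; first by rewrite !mul0r.
by rewrite ler_wpM2l ?strategy_ge0 ?leF.
Qed.

Lemma weights_sum1 : p * 1 + q * 1 = 1.
Proof. by rewrite !mulr1 addrC subrK. Qed.

Definition position r (h : history n) := uniq (claimed h) /\ (size h + r)%N = N.

Lemma position_ongoing r h : position r.+1 h -> ongoing h.
Proof. by case=> uniq_h size_h; rewrite /ongoing uniq_h -size_h addnS ltnS leq_addr. Qed.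

Lemma position_rcons r h w e :
  position r.+1 h -> e \notin claimed h -> position r (rcons h (w, e)).
Proof.
case=> uniq_h size_h e_free; split; last by rewrite size_rcons addSnnS.
by rewrite /claimed map_rcons rcons_uniq e_free.
Qed.

Lemma legal_free (S : strategy R n) h e : ongoing h -> S h e != 0 -> e \notin claimed h.
Proof. by move=> ong; apply: contraNN => /(strategy_legal S ong) ->. Qed.

Lemma value_bounds r h : position r h -> 0 <= value r h <= 1.
Proof.
elim: r h => [|r IHr] h pos; first by rewrite /= ler0n lern1 leq_b1.
have ong := position_ongoing pos.
have bounds w (S : strategy R n) e : S h e != 0 -> 0 <= value r (rcons h (w, e)) <= 1.
  by move=> /(legal_free ong) /(position_rcons w pos); apply: IHr.
have [p0 p1] := andP p_prob; have q0 : 0 <= q by rewrite subr_ge0.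
have EM0 : 0 <= \sum_e SM h e * value r (rcons h (Maker, e)).
  by apply: expect_ge => // e /(bounds Maker) /andP[].
have EB0 : 0 <= \sum_e SB h e * value r (rcons h (Breaker, e)).
  by apply: expect_ge => // e /(bounds Breaker) /andP[].
have EM1 : \sum_e SM h e * value r (rcons h (Maker, e)) <= 1.
  by apply: expect_le => // e /(bounds Maker) /andP[].
have EB1 : \sum_e SB h e * value r (rcons h (Breaker, e)) <= 1.
  by apply: expect_le => // e /(bounds Breaker) /andP[].
rewrite valueS addr_ge0 ?mulr_ge0 //=.
by rewrite -[leRHS]weights_sum1 lerD ?ler_wpM2l.
Qed.

(** * Breaker's successive attempts *)

Definition untouched (h : history n) : {set 'I_n} := [set v | maker_isolated h v].

Definition available (h : history n) (v : 'I_n) : nat :=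
  #|[set e | incident v e & e \notin claimed h]|.

Lemma maker_isolated_rcons (h : history n) w (e : edge n) v :
  maker_isolated (rcons h (w, e)) v =
    maker_isolated h v && ((w == Maker) ==> ~~ incident v e).
Proof. by rewrite /maker_isolated all_rcons andbC. Qed.

Lemma card_untouched_rcons h w e :
  (#|untouched h| <= #|untouched (rcons h (w, e))| + 2)%N.
Proof.
have le2 : (#|[set (val e).1; (val e).2]| <= 2)%N by rewrite cards2; case: eqP.
apply: leq_trans (leq_add (leqnn _) le2).
apply: leq_trans (leq_card_setU _ _); apply/subset_leq_card/fintype.subsetP => v.
rewrite !inE maker_isolated_rcons => -> /=.
by rewrite -/(incident v e); case: (incident v e); rewrite ?orbT ?implybT.
Qed.

Lemma available_rcons h w e v : e \notin claimed h ->
  available h v = (incident v e + available (rcons h (w, e)) v)%N.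
Proof.
move=> e_free; rewrite /available (cardsD1 e) inE e_free andbT; congr addn.
apply: eq_card => e'; rewrite !inE /claimed map_rcons mem_rcons inE negb_or.
by rewrite andbCA.
Qed.

(** An edge at v is determined by its other endpoint. *)
Lemma available_le h v : (available h v <= n)%N.
Proof.
pose other (e : edge n) := if (val e).1 == v then (val e).2 else (val e).1.
rewrite /available -[leqRHS]card_ord -(card_in_imset (f := other)) ?max_card //.
move=> [[a b] /= ab] [[a' b'] /= ab']; rewrite !inE /incident /other /=.
move=> /andP[+ _] /andP[+ _]; rewrite !(eq_sym v).
have [av _|_ /= /eqP bv] := eqVneq a v;
  have [av' _|_ /= /eqP bv'] := eqVneq a' v => eq_other; apply: val_inj => /=.
- by rewrite av av' eq_other.
- by move: ab ab'; rewrite av eq_other bv' => /ltn_trans lt /lt; rewrite ltnn.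
- by move: ab ab'; rewrite av' bv eq_other => lt /(ltn_trans lt); rewrite ltnn.
- by rewrite bv bv' eq_other.
Qed.

Lemma target_exists h : (0 < #|untouched h|)%N -> exists v, target h v.
Proof.
case/card_gt0P => v0; rewrite inE => iso0.
case: (@arg_minnP _ v0 (maker_isolated h) (@nat_of_ord n) iso0) => v iso_v min_v.
by exists v; split=> // u; rewrite ltnNge; apply: contraNN; apply: min_v.
Qed.

Local Notation A := (1 - q ^+ n).

(* A lost attempt costs a factor [A] in the bound, and Maker's move two of the
   untouched vertices; the current attempt needs [available h v] more wins. *)
Lemma value_target r h v i : position r h -> target h v ->
  (i.*2 < #|untouched h|)%N ->
  1 - A ^+ i * (1 - q ^+ available h v) <= value r h.
Proof.
have [p0 p1] := andP p_prob.
have q0 : 0 <= q by rewrite subr_ge0.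
have q1 : q <= 1 by rewrite lerBlDr lerDl.
have qX m : 0 <= 1 - q ^+ m by rewrite subr_ge0 exprn_ile1.
have A1 : A <= 1 by rewrite lerBlDr lerDl exprn_ge0.
elim: r h v i => [|r IHr] h v i pos tv lt_i.
  have -> : value 0 h = 1 by rewrite /=; case: existsP => // -[]; exists v; case: tv.
  by rewrite lerBlDr lerDl mulr_ge0 ?exprn_ge0.
have ong := position_ongoing pos.
rewrite valueS; have [iso_v min_v] := tv.
have target_rcons w e : ~~ ((w == Maker) && incident v e) -> target (rcons h (w, e)) v.
  rewrite negb_and -implybE => safe; split; first by rewrite maker_isolated_rcons iso_v.
  by move=> u /min_v; rewrite maker_isolated_rcons negb_and => ->.
(* With no free edge at v the attempt has succeeded: v remains the target whatever is played, and
   the induction hypothesis with i = 0 gives value 1. *)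
have [m0|m_gt0] := posnP (available h v).
  rewrite m0 expr0 subrr mulr0 subr0.
  have one w (S : strategy R n) : 1 <= \sum_e S h e * value r (rcons h (w, e)).
    apply: expect_ge => // e /(legal_free ong) e_free.
    have := available_rcons w v e_free; rewrite m0.
    move=> /esym/eqP; rewrite addn_eq0 eqb0 => /andP[inc /eqP m'0].
    have tv' : target (rcons h (w, e)) v by apply: target_rcons; rewrite (negPf inc) andbF.
    have /(IHr _ _ 0 (position_rcons w pos e_free) tv') : (0 < #|untouched (rcons h (w, e))|)%N.
      by apply/card_gt0P; exists v; rewrite inE; case: tv'.
    by rewrite m'0 subrr mulr0 subr0.
  by rewrite -[leLHS]weights_sum1 lerD ?ler_wpM2l.
(* If i = 0 the bound is trivial. Otherwise one spare attempt is used up on the lowest vertex still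
   untouched, which has at most n free edges. *)
have EM : 1 - A ^+ i <= \sum_e SM h e * value r (rcons h (Maker, e)).
  apply: expect_ge => // e /(legal_free ong) e_free.
  have pos' := position_rcons Maker pos e_free.
  have := card_untouched_rcons h Maker e.
  case: i lt_i => [_ _|i lt_i le_u].
    by rewrite expr0 subrr; have /andP[] := value_bounds pos'.
  have lt_i' : (i.*2 < #|untouched (rcons h (Maker, e))|)%N.
    by move: (leq_trans lt_i le_u); rewrite doubleS addn2 !ltnS.
  have [v' tv'] := target_exists (leq_ltn_trans (leq0n _) lt_i').
  apply: le_trans (IHr _ _ _ pos' tv' lt_i').
  rewrite lerB // exprSr ler_wpM2l ?exprn_ge0 // lerB //.
  by rewrite ler_wiXn2l ?available_le.
have EB : 1 - A ^+ i * (1 - q ^+ (available h v).-1)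
          <= \sum_e SB h e * value r (rcons h (Breaker, e)).
  apply: expect_ge => // e SB_e; have [e_free good] := SB_good ong SB_e.
  have inc : incident v e.
    apply: good => //; have /card_gt0P[e'] := m_gt0; rewrite inE => /andP[inc' free'].
    by exists e'.
  rewrite (available_rcons Breaker v e_free) inc /=.
  apply: IHr; [exact: position_rcons|exact: target_rcons|].
  apply: leq_trans lt_i _; apply/subset_leq_card/fintype.subsetP => u.
  by rewrite !inE maker_isolated_rcons andbT.
(* This rests on 1 - q^(m+1) = p + q (1 - q^m): the bound is exactly the average of the two
   cases. *)
have -> : 1 - A ^+ i * (1 - q ^+ available h v) =
    p * (1 - A ^+ i) + q * (1 - A ^+ i * (1 - q ^+ (available h v).-1)).
  case: (available h v) m_gt0 => // m _; rewrite exprS /=.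
  by move: (A ^+ i) (q ^+ m) => a b; ring.
by rewrite lerD ?ler_wpM2l.
Qed.

Lemma isolation_prob_bounds : (0 < n)%N ->
  1 - A ^+ n.-1./2 <= isolation_prob p SM SB <= 1.
Proof.
move=> n_gt0; have [p0 p1] := andP p_prob.
have pos : position N [::] by [].
have -> : isolation_prob p SM SB = value N [::] by rewrite -sum_play_prob.
have /andP[_ ->] := value_bounds pos; rewrite andbT.
have all_u : untouched [::] = [set: 'I_n] by apply/setP => v; rewrite !inE.
have [v tv] : exists v, target ([::] : history n) v.
  by apply: target_exists; rewrite all_u cardsT card_ord.
(* This is the largest i with 2i < n. The attempt in progress at the start is given away by bounding
   its failure probability by 1. *)
apply: le_trans (value_target (i := n.-1./2) pos tv _).
  rewrite lerB // -[leRHS]mulr1 ler_wpM2l //.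
    by rewrite exprn_ge0 // subr_ge0 exprn_ile1 ?subr_ge0 // lerBlDr lerDl.
  by rewrite lerBlDr lerDl exprn_ge0 ?subr_ge0.
by rewrite all_u cardsT card_ord; lia.
Qed.

End Value.

(** * Asymptotics *)

Section Asymptotics.
Variable R : realType.

(** The chain is (1 - y)^i <= exp(- i y) <= 1 / (1 + i y) <= 1 / (i y). *)
Lemma one_minus_expn_le (y : R) i : 0 <= y <= 1 -> 0 < i%:R * y ->
  (1 - y) ^+ i <= (i%:R * y)^-1.
Proof.
case/andP=> y0 y1 iy_gt0.
have : (1 - y) ^+ i <= expR (- y) ^+ i.
  by rewrite lerXn2r ?nnegrE ?subr_ge0 ?expR_ge0 // expR_ge1Dx.
move/le_trans; apply; rewrite -expRM_natl mulrN expRN.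
rewrite lef_pV2 ?posrE ?expR_gt0 //.
by apply: le_trans (expR_ge1Dx _); rewrite lerDr.
Qed.

(** The inequality exp x >= 1 + x at x = (ln n) / 2 gives ln n <= 2 sqrt n. It serves to make (ln n)
    / n small. *)
Lemma ln_sqr_le (n : nat) : (0 < n)%N -> ln (n%:R : R) ^+ 2 <= 4 * n%:R.
Proof.
move=> n_gt0; have nR : (0 : R) < n%:R by rewrite ltr0n.
have l0 : (0 : R) <= ln n%:R by rewrite ln_ge0 // ler1n.
have e2 : (n%:R : R) = expR (ln n%:R / 2) ^+ 2.
  by rewrite -expRM_natl mulrC divfK // lnK.
have x_ge := expR_ge1Dx (ln (n%:R : R) / 2).
rewrite [in leRHS]e2; move: (ln _) (expR _) l0 x_ge {e2} => l x l0 x_ge.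
have lx : l <= 2 * x by lra.
have -> : 4 * x ^+ 2 = (2 * x) ^+ 2 by ring.
by rewrite lerXn2r // nnegrE ?(le_trans l0).
Qed.

Lemma miss_prob_le (eps p : R) n : 0 < eps -> 0 <= p <= 1 -> (2 < n)%N ->
  4 / eps <= ln n%:R -> p <= (1 - eps) * ln n%:R / n%:R ->
  (1 - (1 - p) ^+ n) ^+ n.-1./2 <= 4 / (eps ^+ 2 * ln n%:R).
Proof.
move=> eps0 /andP[p0 p1] n_gt2 ln_big p_le.
have nR : (0 : R) < n%:R by rewrite ltr0n; lia.
have lsq := ln_sqr_le (ltnW (ltnW n_gt2)).
have pn : p * n%:R <= (1 - eps) * ln n%:R by rewrite -ler_pdivlMr.
have l0 : (0 : R) < ln n%:R by apply: lt_le_trans ln_big; rewrite divr_gt0.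
have ln_big' : 4 <= ln n%:R * eps by rewrite -ler_pdivrMr.
have enl : n%:R = expR (ln n%:R) :> R by rewrite lnK.
move: (ln n%:R) lsq pn l0 ln_big' enl {ln_big p_le} => l lsq pn l0 ln_big enl.
(* From 4 <= eps l and l^2 <= 4n follows l <= eps n, while (1 + eps) p n <= (1 - eps^2) l <= l. *)
have p_small : (1 + eps) * p <= eps.
  rewrite -(ler_pM2r nR) -mulrA.
  have : (1 + eps) * (p * n%:R) <= (1 + eps) * ((1 - eps) * l).
    by rewrite ler_wpM2l // addr_ge0 // ltW.
  have : l ^+ 2 * eps <= 4 * n%:R * eps by rewrite ler_pM2r.
  nra.
have q_gt0 : 0 < 1 - p by nra.
(* This fails at n = 2, whence the hypothesis 2 < n. *)
have n4 : (n%:R : R) <= 4 * (n.-1./2)%:R by rewrite -natrM ler_nat; lia.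
(* It suffices that (1 + (1 + eps) p) (1 - p) >= 1, that is p (eps - (1 + eps) p) >= 0, which is
   what [p_small] provides. *)
have q_ge : expR (- ((1 + eps) * p)) <= 1 - p.
  rewrite expRN -[leRHS]invrK lef_pV2 ?posrE ?expR_gt0 ?invr_gt0 //.
  apply: le_trans (expR_ge1Dx _).
  by rewrite -[leLHS]mul1r ler_pdivrMr //; nra.
have qn_ge : expR (- ((1 - eps ^+ 2) * l)) <= (1 - p) ^+ n.
  have := lerXn2r n (expR_ge0 _ : _ \is Num.nneg) (ltW q_gt0 : _ \is Num.nneg) q_ge.
  apply: le_trans; rewrite -expRM_natl ler_expR; nra.
have nq : eps ^+ 2 * l <= n%:R * (1 - p) ^+ n.
  have : n%:R * expR (- ((1 - eps ^+ 2) * l)) <= n%:R * (1 - p) ^+ n.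
    by rewrite ler_pM2l.
  apply: le_trans; rewrite [in leRHS]enl -expRD.
  have -> : l + - ((1 - eps ^+ 2) * l) = eps ^+ 2 * l by ring.
  by apply: le_trans (expR_ge1Dx _); rewrite lerDr.
have iy : eps ^+ 2 * l / 4 <= (n.-1./2)%:R * (1 - p) ^+ n.
  rewrite ler_pdivrMr // (le_trans nq) // [leRHS]mulrAC // ler_wpM2r ?exprn_ge0 ?(ltW q_gt0) //.
  by rewrite mulrC.
have iy0 : 0 < eps ^+ 2 * l / 4 by rewrite divr_gt0 // mulr_gt0 // exprn_gt0.
apply: (le_trans (one_minus_expn_le _ (lt_le_trans iy0 iy))).
  by rewrite exprn_ge0 ?exprn_ile1 ?(ltW q_gt0) //= lerBlDr lerDl.
by rewrite -[leRHS]invrK invf_div lef_pV2 // posrE // (lt_le_trans iy0).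
Qed.

End Asymptotics.

Local Open Scope classical_set_scope.

Theorem theorem1p5 (R : realType) (eps : R) (p : nat -> R)
  (eps_gt0 : 0 < eps)
  (p_prob : forall n : nat, 0 <= p n <= 1)
  (p_le : \forall n \near \oo, p n <= (1 - eps) * ln (n%:R : R) / n%:R) :
  exists B : forall n : nat, strategy R n,
    efficient B /\
    forall M : forall n : nat, strategy R n,
      (fun n : nat => isolation_prob (p n) (M n) (B n)) @ \oo --> (1 : R).
Proof.
exists (breaker_strategy R); split; first exact: breaker_efficient.
move=> M; apply/cvgrPdist_le => d d_gt0.
have ln_large K : \forall n \near \oo, K <= ln (n%:R : R).
  near=> n.
  rewrite -(expRK K) ler_ln ?posrE ?expR_gt0 //.
    by near: n; apply: nbhs_infty_ger.
  by rewrite ltr0n; near: n; apply: nbhs_infty_gt.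
near=> n.
have n_gt2 : (2 < n)%N by near: n; apply: nbhs_infty_gt.
have /andP[lo hi] := isolation_prob_bounds (M n) (SB := breaker_strategy R n)
  (p_prob n) (@breaker_prob_good R n) (ltnW (ltnW n_gt2)).
rewrite ger0_norm ?subr_ge0 // lerBlDr -lerBlDl (le_trans _ lo) // lerB //.
apply: (le_trans (miss_prob_le eps_gt0 (p_prob n) n_gt2 _ _)).
- by near: n; apply: ln_large.
- by near: n.
have l0 : 0 < ln (n%:R : R) by rewrite ln_gt0 // ltr1n ltnW.
(* This threshold makes 4 / (eps^2 ln n) at most d. *)
have : 4 / (d * eps ^+ 2) <= ln (n%:R : R) by near: n; apply: ln_large.
rewrite !ler_pdivrMr ?mulr_gt0 ?exprn_gt0 // => /le_trans; apply.
by rewrite mulrC -mulrA.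
Unshelve. all: by end_near.
Qed.
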